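(* Let $T$ be a tree of order at least two and let $r\ge 1$ be an integer. Then $$\mathrm{M}_+^{\mathbb{R}}(T\,\square\, K_r)=\mathrm{M}_+^{\mathbb{C}}(T\,\square\, K_r)=\mathrm{Z}_+(T\,\square\, K_r)=r.$$
   Context: All graphs are finite, simple, undirected, with nonempty vertex set. $K_r$ is the complete graph on $r$ vertices. The Cartesian product $G\,\square\, H$ has vertex set $V_G\times V_H$, with two vertices adjacent exactly when they are identical in one coordinate and adjacent in the other. For a graph $G$ with vertex set identified with $\{1,\dots,n\}$ and an $n\times n$ Hermitian matrix $A$, the graph $\mathcal{G}(A)$ has vertices $\{1,\dots,n\}$ and edges $\{i,j\}$, $i<j$, exactly when $a_{ij}\neq 0$ (the diagonal is ignored). $\mathrm{M}_+^{\mathbb{R}}(G)$ (resp. $\mathrm{M}_+^{\mathbb{C}}(G)$) is the maximum of $\dim\ker A$ over all real symmetric (resp. complex Hermitian) positive semidefinite $n\times n$ matrices $A$ with $\mathcal{G}(A)=G$. Positive semidefinite color change rule: let $B$ be the set of all currently black vertices of $G$ (all other vertices are white), and let $W_1,\dots,W_k$ be the vertex sets of the connected components of $G-B$ (possibly $k=1$). If $u\in B$, $w\in W_i$, and $w$ is the only white neighbor of $u$ in the induced subgraph $G[W_i\cup B]$, then change the color of $w$ to black. A positive semidefinite zero forcing set is a set $X\subseteq V_G$ such that, starting with exactly the vertices of $X$ black and applying this rule repeatedly (recomputing $B$ and the components each time) until no more changes are possible, all vertices become black. $\mathrm{Z}_+(G)$ is the minimum of $|X|$ over all positive semidefinite zero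 forcing sets $X$. *)

(* Defs.v *)
From HB Require Import structures.
From mathcomp Require Import all_boot all_order all_algebra.
From mathcomp Require Import boolp reals.
From mathcomp Require Import complex.

Set Implicit Arguments.
Unset Strict Implicit.
Unset Printing Implicit Defensive.

Import Order.TTheory GRing.Theory Num.Theory.

Local Open Scope sesquilinear_scope.
Local Open Scope ring_scope.
Local Open Scope nat_scope.

Record sgraph := SGraph {
  svertex :> finType;
  sedge : rel svertex;
  sedge_sym : symmetric sedge;
  sedge_irr : irreflexive sedge }.

Notation "x -- y" := (sedge x y) (at level 30, no associativity).

(* Since sedge is irreflexive and symmetric, a cycle of the graph is a
   duplicate-free closed walk of length at least 3: x -- y -- x is a ucycle
   of size 2 for every edge. *)
Definition is_tree (T : sgraph) : Prop :=
  [/\ 0 < #|T|,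
      forall x y : T, connect (@sedge T) x y
    & forall c : seq T, ucycle (@sedge T) c -> size c < 3].

Section Complete.
Variable r : nat.

Definition complete_rel : rel 'I_r := fun i j => i != j.

Lemma complete_rel_sym : symmetric complete_rel.
Proof. by move=> i j; rewrite /complete_rel eq_sym. Qed.

Lemma complete_rel_irr : irreflexive complete_rel.
Proof. by move=> i; rewrite /complete_rel eqxx. Qed.

Definition complete_graph : sgraph := SGraph complete_rel_sym complete_rel_irr.
End Complete.

Section CartesianProduct.
Variables G H : sgraph.

Definition cart_rel : rel (G * H) := fun x y =>
  ((x.1 == y.1) && (x.2 -- y.2)) || ((x.2 == y.2) && (x.1 -- y.1)).

Lemma cart_rel_sym : symmetric cart_rel.
Proof.
by move=> x y; rewrite /cart_rel !(sedge_sym y.1, sedge_sym y.2) !(eq_sym y.1, eq_sym y.2).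
Qed.

Lemma cart_rel_irr : irreflexive cart_rel.
Proof. by move=> x; rewrite /cart_rel !sedge_irr !andbF. Qed.

Definition cart_prod : sgraph := SGraph cart_rel_sym cart_rel_irr.
End CartesianProduct.

Section MatrixGraph.
Variables (F : numFieldType) (n : nat) (A : 'M[F]_n).

Definition mxgraph_rel : rel 'I_n := fun i j =>
  ((i < j) && (A i j != 0%R)) || ((j < i) && (A j i != 0%R)).

Lemma mxgraph_rel_sym : symmetric mxgraph_rel.
Proof. by move=> i j; rewrite /mxgraph_rel orbC. Qed.

Lemma mxgraph_rel_irr : irreflexive mxgraph_rel.
Proof. by move=> i; rewrite /mxgraph_rel ltnn. Qed.

Definition mxgraph : sgraph := SGraph mxgraph_rel_sym mxgraph_rel_irr.
End MatrixGraph.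

(* The vertices of G are identified with 'I_#|G| along enum_rank. *)
Definition mx_of_graph (F : numFieldType) (G : sgraph) (A : 'M[F]_#|G|) : Prop :=
  forall u v : G,
    (enum_rank u : mxgraph A) -- (enum_rank v : mxgraph A) = u -- v.

(* theta is the identity for real symmetric matrices, and the conjugation for
   complex Hermitian ones.  In the order of R[i], 0 <= z means that z is real
   and nonnegative. *)
Definition psdmx (F : numFieldType) (theta : F -> F) n (A : 'M[F]_n) : Prop :=
  A \is hermitianmx n false theta /\
  forall x : 'cV[F]_n, (0 <= ((x ^t theta) *m A *m x) 0 0)%R.

(* kermx is the kernel of the action on row vectors, hence the transpose. *)
Definition nullity (F : fieldType) n (A : 'M[F]_n) : nat := \rank (kermx A^T).

(* The nullities range over 0, ..., #|G|, whence the bound on k. *)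
Definition max_psd_nullity (F : numFieldType) (theta : F -> F) (G : sgraph) : nat :=
  \max_(k < #|G|.+1 | `[< exists A : 'M[F]_#|G|,
      [/\ psdmx theta A, mx_of_graph A & nullity A = k] >]) k.

Definition MplusR (R : realType) (G : sgraph) : nat :=
  max_psd_nullity (@idfun R) G.

Definition MplusC (R : realType) (G : sgraph) : nat :=
  max_psd_nullity (@Num.conj R[i]) G.

Section PsdZeroForcing.
Variable G : sgraph.
Implicit Types (B W X : {set G}) (u w : G).

Definition white_rel B : rel G :=
  fun x y => [&& x \notin B, y \notin B & x -- y].

(* The vertex sets of the connected components of G - B. *)
Definition white_components B : {set {set G}} :=
  equivalence_partition (connect (white_rel B)) (~: B).

Definition psd_forces B u w : bool :=
  [exists W in white_components B,
    [&& u \in B, w \in W &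
        [set v in W :|: B | (v \notin B) && (u -- v)] == [set w]]].

Definition psd_step : rel {set G} := fun B B' =>
  [exists u, exists w, psd_forces B u w && (B' == w |: B)].

(* Once all the vertices are black, no rule applies; so a successful run of the
   process is a sequence of steps from X to the whole vertex set. *)
Definition psd_forcing_set X : bool := connect psd_step X [set: G].

(* [set: G] is itself a forcing set, so the minimum is over a nonempty family. *)
Definition Zplus : nat :=
  #|[arg min_(X < [set: G] | psd_forcing_set X) #|X| ]|.
End PsdZeroForcing.

(* Main.v *)
(* We prove r <= M_+ <= Z_+ <= r, over both fields at once.
   A fiber {x0} x K_r is a positive semidefinite zero forcing set: T grows from
   x0 by adding neighbours one at a time, and acyclicity ensures that a black
   fiber forces each adjacent white fiber.
   A kernel vector x of a positive semidefinite A that vanishes on a black set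
   B restricts, on each component of G - B, to an isotropic vector of A, hence
   to a kernel vector; so x also vanishes on the forced vertex.  Hence a kernel
   vector vanishing on a forcing set is 0, which gives M_+ <= Z_+.
   For r <= M_+, root T and take A = N N^T where N has an r-column block for
   each of the |T| - 1 edges, supported on the two fibers of that edge: its rank
   is at most (|T| - 1) r. *)
Require Import Defs.
From mathcomp Require Import all_boot all_order all_algebra reals complex boolp.
From mathcomp Require Import ring zify.

Set Implicit Arguments.
Unset Strict Implicit.
Unset Printing Implicit Defensive.

Import Order.TTheory GRing.Theory Num.Theory.

(** * Paths, growth from a root and parent maps in trees *)

Section Graphs.
Variable G : sgraph.
Implicit Types (B S : {set G}).

Lemma white_rel_path B x p :
  x \notin B -> path (white_rel B) x p ->
  path (@sedge G) x p /\ all (fun y => y \notin B) p.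
Proof.
elim: p x => //= y p IHp x xB /andP[/and3P[_ yB xy] /(IHp _ yB)[-> ->]].
by rewrite xy yB.
Qed.

Lemma white_connect_notin B x y :
  x \notin B -> connect (white_rel B) x y -> y \notin B.
Proof.
move=> xB /connectP[p /(white_rel_path xB)[_ pB] ->].
have/allP: all (fun z => z \notin B) (x :: p) by rewrite /= xB.
by apply; apply: mem_last.
Qed.

Lemma white_connectS B B' x y :
  B \subset B' -> connect (white_rel B') x y -> connect (white_rel B) x y.
Proof.
move=> /subsetP BB'; apply: connect_sub => {}x {}y /and3P[xB yB xy].
apply: connect1; rewrite /white_rel xy andbT.
by rewrite (contra (BB' x)) ?(contra (BB' y)).
Qed.

(** Without such an edge [S] would be closed under adjacency, hence everything by connectedness. *)
Lemma boundary_edge S x0 :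
    (forall x y : G, connect (@sedge G) x y) -> x0 \in S -> S != [set: G] ->
  exists u w, [/\ u \in S, w \notin S & u -- w].
Proof.
move=> conn Sx0 SnT.
have [/existsP[u /existsP[w /and3P[*]]]|noedge] :=
  boolP [exists u, exists w, [&& u \in S, w \notin S & u -- w]].
  by exists u, w.
have bd u w : u -- w -> u \in S -> w \in S.
  move=> uw uS; apply: contraR noedge => wS.
  by apply/existsP; exists u; apply/existsP; exists w; apply/and3P.
case/eqP: SnT; apply/setP=> y; rewrite inE -(closed_connect _ (conn x0 y)) //.
move=> u w uw; apply/idP/idP; apply: bd => //.
by rewrite sedge_sym.
Qed.

Hypothesis treeG : is_tree G.

(* Two neighbours of u joined by a path avoiding u would close a cycle. *)
Lemma tree_component_nbr B u w w' :
    u \in B -> w \notin B -> u -- w -> u -- w' -> connect (white_rel B) w w' ->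
  w' = w.
Proof.
move=> uB wB uw uw' /connectP[p wp w'E]; subst w'.
case/shortenP: wp uw' => q wq Uq _ uw'.
case: q wq Uq uw' => [//|x q] wq Uq uw'.
have [pq qB] := white_rel_path wB wq.
have uN : u \notin w :: x :: q.
  apply/negP => /= u_in.
  have/allP: all (fun z => z \notin B) (w :: x :: q) by rewrite /= wB.
  by move=> /(_ u u_in); rewrite uB.
have [_ _ /(_ (u :: w :: x :: q))] := treeG.
suff cyc : ucycle (@sedge G) (u :: w :: x :: q) by move=> /(_ cyc).
rewrite /ucycle [uniq _]/= -/(uniq (w :: x :: q)) uN Uq andbT.
have : path (@sedge G) w (rcons (x :: q) u) by rewrite rcons_path pq sedge_sym.
by move=> cyc; rewrite andbT; apply/andP.
Qed.

(** While [S] is proper, a boundary edge supplies the next vertex; the induction is on the number of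
    vertices still missing. *)
Lemma tree_growth_ind (x0 : G) (P : {set G} -> Prop) :
    P [set x0] ->
    (forall S u w, x0 \in S -> u \in S -> w \notin S -> u -- w ->
       P S -> P (w |: S)) ->
  P [set: G].
Proof.
move=> P0 PS; have [_ conn _] := treeG.
suff grow k S : #|~: S| <= k -> x0 \in S -> P S -> P [set: G].
  by apply: (grow _ _ (leqnn _) (set11 x0)).
elim: k S => [|k IHk] S.
  by rewrite leqn0 cards_eq0 -setCT => /eqP/setC_inj ->.
move=> Sk Sx0 PSS; have [<- //|SnT] := eqVneq S [set: G].
have [u [w [uS wS uw]]] := boundary_edge conn Sx0 SnT.
apply: IHk (PS _ _ _ Sx0 uS wS uw PSS); last by rewrite in_setU1 Sx0 orbT.
rewrite -ltnS; apply: leq_trans Sk; apply: proper_card.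
rewrite properEneq; apply/andP; split; last by rewrite setCS subsetUr.
by apply/eqP => /setP/(_ w); rewrite !inE eqxx (negPf wS).
Qed.

(** Along the growth from [x0], each new vertex takes as parent the vertex it is attached to, which
    acyclicity makes its only earlier neighbour. The value [par x0] is unconstrained, so each
    disjunct excludes the root. *)
Lemma tree_parent (x0 : G) : exists par : G -> G,
  forall x y, x -- y = ((x != x0) && (par x == y)) || ((y != x0) && (par y == x)).
Proof.
(* The induction also carries connectedness of [S], which leaves the new vertex a single neighbour
   in [S], and closure of [S] under parents, so that no old vertex has the new one as parent. *)
suff [par [_ _ parE]] : exists par : G -> G,
    [/\ {in [set: G] &, forall x y, connect (white_rel (~: [set: G])) x y},
        {in [set: G] :\ x0, forall x, par x \in [set: G]} &
        {in [set: G] &, forall x y,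
           x -- y = ((x != x0) && (par x == y)) || ((y != x0) && (par y == x))}].
  by exists par => x y; apply: parE; rewrite inE.
elim/(tree_growth_ind (x0 := x0)): [set: G].
  exists id; split=> x; rewrite ?inE; first by move=> y /eqP-> /set1P->.
    by case: eqP.
  by move=> y /eqP-> /set1P->; rewrite eqxx sedge_irr.
move=> S u w Sx0 uS wS uw [par [conn parS parE]].
have wx0 : w != x0 by apply: contraNneq wS => ->.
pose par' x := if x == w then u else par x.
have par'S x : x \in S -> par' x = par x.
  by move=> xS; rewrite /par' ifN //; apply: contraNneq wS => <-.
have par_w x : x \in S -> (x != x0) && (par x == w) = false.
  move=> xS; apply/negP => /andP[xx0 /eqP pxw]; case/negP: wS.
  by rewrite -pxw parS // !inE xx0.
have w_nbr x : x \in S -> (w -- x) = (u == x).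
  move=> xS; apply/idP/eqP => [wx|<-]; last by rewrite sedge_sym.
  (* With the complement of [S] black, [u] and [x] are neighbours of [w] in one white component. *)
  apply/esym; apply: (@tree_component_nbr (~: S) w u x); rewrite ?inE ?negbK //.
    by rewrite sedge_sym.
  exact: conn.
exists par'; split.
- have SwS : ~: (w |: S) \subset ~: S by rewrite setCS subsetUr.
  have uwc : connect (white_rel (~: (w |: S))) u w.
    by apply: connect1; rewrite /white_rel !inE eqxx uS uw orbT.
  have wuc : connect (white_rel (~: (w |: S))) w u.
    by apply: connect1; rewrite /white_rel !inE eqxx uS sedge_sym uw orbT.
  move=> x y /setU1P[->|xS] /setU1P[->|yS] //.
  + by apply: connect_trans wuc _; apply: white_connectS SwS (conn _ _ _ _).
  + by apply: connect_trans uwc; apply: white_connectS SwS (conn _ _ _ _).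
  + exact: white_connectS SwS (conn _ _ _ _).
- move=> x; rewrite !inE => /andP[xx0 /predU1P[->|xS]].
    by rewrite /par' eqxx uS orbT.
  by rewrite par'S // parS ?orbT // !inE xx0.
- move=> x y /setU1P[->|xS] /setU1P[->|yS].
  + rewrite sedge_irr wx0 /par' eqxx /= orbb.
    by apply/esym/negbTE; apply: contraNneq wS => <-.
  + by rewrite w_nbr // wx0 (par'S y) // par_w // orbF /par' eqxx.
  + by rewrite sedge_sym w_nbr // wx0 (par'S x) // par_w // /par' eqxx.
  + by rewrite !par'S // parE.
Qed.

Lemma tree_root_child (x0 : G) : 2 <= #|G| -> exists x, x0 -- x.
Proof.
have [_ conn _] := treeG => G2.
have [|u [w [/set1P-> _ uw]]] := boundary_edge conn (set11 x0); last by exists w.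
by apply/eqP => GE; move: G2; rewrite -cardsT -GE cards1.
Qed.

End Graphs.

(** * Forcing the product from a single fiber *)

Section ProductForcing.
Variables (T : sgraph) (r : nat).
Hypothesis treeT : is_tree T.
Let TK := cart_prod T (complete_graph r).

Definition fibers (S : {set T}) : {set TK} := [set p : TK | p.1 \in S].

(** A step inside a fiber projects to a single vertex, a step between fibers to an edge of [T]. *)
Lemma white_connect_proj (B : {set TK}) (S : {set T}) x y :
  fibers S \subset B -> connect (white_rel B) x y ->
  connect (white_rel S) x.1 y.1.
Proof.
move=> /subsetP SB /connectP[p xp ->]; elim: p x xp => //= z p IHp x.
case/andP=> /and3P[xB zB xz] /IHp; apply: connect_trans.
have fS (t : TK) : t \notin B -> t.1 \notin S.
  by apply: contra => tS; apply: SB; rewrite inE.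
case/orP: xz => /andP[]; first by move=> /eqP->.
by move=> _ xz; apply: connect1; rewrite /white_rel !fS.
Qed.

(* If u lies in a fully black set of fibers, its only white neighbour in the
   component of (w, i) is (w, i), since projecting the component to T cannot
   close a cycle through u. *)
Lemma fiber_forces (B : {set TK}) (S : {set T}) (u w : T) (i : 'I_r) :
    fibers S \subset B -> u \in S -> w \notin S -> u -- w ->
    ((w, i) : TK) \notin B ->
  psd_forces B ((u, i) : TK) ((w, i) : TK).
Proof.
move=> SB uS wS uw wiB.
have fS (t : TK) : t.1 \in S -> t \in B.
  by move=> tS; apply: (subsetP SB); rewrite inE.
pose W := [set y in ~: B | connect (white_rel B) ((w, i) : TK) y].
apply/existsP; exists W; apply/and4P; split.
- by apply: imset_f; rewrite inE.
- exact: fS.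
- by rewrite !inE wiB connect0.
apply/eqP/setP => v; apply/idP/set1P => [|->]; last first.
  by rewrite !inE wiB connect0 /= /cart_rel /= eqxx uw orbT.
rewrite !inE => /and3P[/orP[/andP[_ cv] | -> //] vB /orP[] /andP[/= /eqP e1 e2]].
  by rewrite (fS v) -?e1 in vB.
have := tree_component_nbr treeT uS wS uw e2 (white_connect_proj SB cv).
by case: v e1 {e2 vB cv} => a b /= -> ->.
Qed.

Lemma fibers_connect (S : {set T}) (u w : T) :
    u \in S -> w \notin S -> u -- w ->
  connect (@psd_step TK) (fibers S) (fibers (w |: S)).
Proof.
move=> uS wS uw.
(* The fiber of [w] is blackened one vertex at a time, [(w, i)] being forced by [(u, i)]; [s] lists
   the indices already treated. *)
suff grow (s : seq 'I_r) : connect (@psd_step TK) (fibers S)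
    [set p : TK | (p.1 \in S) || ((p.1 == w) && (p.2 \in s))].
  have := grow (enum 'I_r); congr (connect _ _ _); apply/setP => p.
  by rewrite !inE mem_enum andbT orbC.
elim: s => [|i s IHs].
  by apply: eq_connect0; apply/setP => p; rewrite !inE andbF orbF.
apply: connect_trans IHs _.
have [i_s|i_s] := boolP (i \in s).
  apply: eq_connect0; apply/setP => p; rewrite !inE.
  by congr (_ || (_ && _)); have [->|] := eqVneq p.2 i.
apply: connect1; apply/existsP; exists ((u, i) : TK).
apply/existsP; exists ((w, i) : TK); apply/andP; split.
  apply: (fiber_forces _ uS wS uw); last by rewrite inE /= (negPf wS) (negPf i_s) andbF.
  by apply/subsetP => p; rewrite !inE => ->.
apply/eqP/setP => -[a b]; rewrite !inE xpair_eqE /= andb_orr.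
by rewrite !orbA; congr (_ || _); rewrite orbC.
Qed.

Lemma fiber_psd_forcing_set (x0 : T) : psd_forcing_set (fibers [set x0]).
Proof.
rewrite /psd_forcing_set.
have -> : [set: TK] = fibers [set: T] by apply/setP => p; rewrite !inE.
elim/(tree_growth_ind treeT (x0 := x0)): [set: T]; first exact: connect0.
by move=> S u w _ uS wS uw /connect_trans; apply; apply: fibers_connect uw.
Qed.

Lemma card_fiber (x0 : T) : #|fibers [set x0]| = r.
Proof.
have -> : fibers [set x0] = setX [set x0] [set: 'I_r].
  by apply/setP => p; rewrite !inE andbT.
by rewrite cardsX cards1 cardsT card_ord mul1n.
Qed.

Lemma Zplus_le : Zplus TK <= r.
Proof.
have [T0 _ _] := treeT; have [x0 _] := card_gt0P T0.
rewrite -[leqRHS](card_fiber x0) /Zplus; case: arg_minnP; first exact: connect0.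
by move=> X _; apply; apply: fiber_psd_forcing_set.
Qed.

End ProductForcing.

(** * Kernels of positive semidefinite matrices and forcing sets *)

Section PsdNullity.
Local Open Scope ring_scope.
Local Open Scope sesquilinear_scope.
Variables (F : numFieldType) (theta : {rmorphism F -> F}).
Hypothesis theta_ge0 : forall x, 0 <= theta x * x.

(** The entry is a sum of terms [theta (w i 0) * w i 0], nonnegative by [theta_ge0]: squares for the
    identity, squared moduli for conjugation. *)
Lemma adj_mul_eq0 n (w : 'cV[F]_n) : (w ^t theta *m w) 0 0 = 0 -> w = 0.
Proof.
rewrite mxE => /eqP; rewrite psumr_eq0; last by move=> i _; rewrite !mxE.
move=> /allP w0; apply/matrixP => i j; rewrite ord1 mxE.
have := w0 i (mem_index_enum _); rewrite !mxE mulf_eq0 fmorph_eq0 orbb.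
by move/eqP.
Qed.

Lemma hermitianmx_theta n (A : 'M[F]_n) i j :
  A \is hermitianmx n false theta -> A i j = theta (A j i).
Proof. by move/is_hermitianmxP => {1}->; rewrite expr0 scale1r !mxE. Qed.

Lemma mxgraph_relE n (A : 'M[F]_n) i j :
  A \is hermitianmx n false theta -> i != j -> mxgraph_rel A i j = (A i j != 0).
Proof.
move=> herm ij; rewrite /mxgraph_rel (hermitianmx_theta j i herm) fmorph_eq0.
by rewrite -andb_orl -neq_ltn ij.
Qed.

Hypothesis thetaK : involutive theta.

(* Otherwise the form would be negative at [t *: y + A *m y] for some
   [t < 0]. *)
Lemma psd_isotropic_ker n (A : 'M[F]_n) (y : 'cV[F]_n) :
  psdmx theta A -> (y ^t theta *m A *m y) 0 0 = 0 -> A *m y = 0.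
Proof.
move=> [herm pos] y0; have [w wE] : exists w, w = A *m y by exists (A *m y).
rewrite -wE.
have A_herm : A ^t theta = A.
  by apply/matrixP => i j; rewrite [RHS](hermitianmx_theta i j herm) !mxE.
have w_adj : w ^t theta = y ^t theta *m A.
  by rewrite wE trmx_mul map_mxM A_herm.
pose s := (w ^t theta *m w) 0 0; pose a := (w ^t theta *m A *m w) 0 0.
have s_ge0 : 0 <= s by rewrite /s mxE sumr_ge0 // => i _; rewrite !mxE.
have a_ge0 : 0 <= a by exact: pos.
have theta00 (M : 'M[F]_1) : theta (M 0 0) = (M ^t theta) 0 0 by rewrite !mxE.
have wwT : (w ^t theta) ^t theta = w.
  by apply/matrixP => i j; rewrite !mxE thetaK.
have theta_s : theta s = s.
  by rewrite /s theta00 trmx_mul map_mxM wwT.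
have theta_a : theta a = a.
  by rewrite /a theta00 !trmx_mul !map_mxM wwT A_herm mulmxA.
(* Isotropy of [y] removes the quadratic term in [t], so the form at [t *: y + w] is affine in
   [t]. *)
have form t : theta t = t -> 0 <= a + t * s *+ 2.
  move=> tt; have := pos (t *: y + w).
  have -> : (t *: y + w) ^t theta = t *: y ^t theta + w ^t theta.
    by apply/matrixP => i j; rewrite !mxE rmorphD rmorphM tt.
  rewrite !mulmxDl !mulmxDr -!scalemxAl -!scalemxAr.
  have addE (M N : 'M[F]_1) : (M + N) 0 0 = M 0 0 + N 0 0 by rewrite mxE.
  have scaleE (M : 'M[F]_1) : (t *: M) 0 0 = t * M 0 0 by rewrite mxE.
  rewrite !(addE, scaleE) y0 -(mulmxA _ A y) -wE -w_adj -/s -/a.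
  by congr (_ <= _); ring.
apply: adj_mul_eq0; rewrite -/s; apply/eqP; apply: contraT => s_neq0.
have s2_neq0 : s *+ 2 != 0 by rewrite mulrn_eq0.
(* This [t] gives the affine expression the value -1. *)
have := form (- (a + 1) / (s *+ 2)).
rewrite fmorph_div rmorphN rmorphD rmorph1 rmorphMn /= theta_a theta_s.
move=> /(_ erefl); rewrite -mulrnAr divfK //.
by rewrite opprD addrA subrr add0r oppr_ge0 ler10.
Qed.

Variable G : sgraph.

Lemma mx_of_graph_neq0 (A : 'M[F]_#|G|) i j :
    A \is hermitianmx #|G| false theta -> mx_of_graph A -> i != j ->
  (A i j != 0) = sedge (enum_val i) (enum_val j).
Proof.
move=> herm AG ij; rewrite -AG !enum_valK -(mxgraph_relE herm ij) //.
Qed.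

Lemma psd_step_ker (A : 'M[F]_#|G|) (x : 'cV[F]_#|G|) (B B' : {set G}) :
    psdmx theta A -> mx_of_graph A -> A *m x = 0 -> psd_step B B' ->
    (forall i, enum_val i \in B -> x i 0 = 0) ->
  (forall i, enum_val i \in B' -> x i 0 = 0).
Proof.
move=> psdA AG Ax /existsP[u /existsP[w /andP[/existsP[W]]]].
move=> /and4P[/imsetP[z zB WE] uB wW /eqP/setP forced] /eqP -> xB.
have herm := psdA.1.
have WB v : v \in W -> v \notin B by rewrite WE !inE => /andP[].
pose y : 'cV[F]_#|G| := \col_i (if enum_val i \in W then x i 0 else 0).
(* On rows in [W] the products with [x] and [y] agree: [x] vanishes on [B], and no edge joins [W] to
   another white component. *)
have AyW i : enum_val i \in W -> (A *m y) i 0 = 0.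
  move=> iW; transitivity ((A *m x) i 0); last by rewrite Ax mxE.
  rewrite !mxE; apply: eq_bigr => j _; rewrite mxE.
  case: ifPn => // jW; have [jB|jB] := boolP (enum_val j \in B).
    by rewrite xB.
  suff -> : A i j = 0 by rewrite !mul0r.
  have ij : i != j by apply: contraNneq jW => <-.
  apply/eqP; rewrite -[_ == _]negbK (mx_of_graph_neq0 herm AG ij).
  apply: contra jW => edge; move: iW; rewrite WE !inE jB => /andP[iB zi] /=.
  by apply: connect_trans zi _; apply: connect1; rewrite /white_rel iB jB.
(* Each term of the form at [y] vanishes: on [W] through [A *m y], off [W] through [y]. *)
have Ay : A *m y = 0.
  apply: psd_isotropic_ker => //; rewrite -mulmxA mxE big1 // => i _.
  have [iW|iW] := boolP (enum_val i \in W); first by rewrite AyW // mulr0.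
  by rewrite !mxE (negPf iW) rmorph0 mul0r.
move=> i /setU1P[iw|]; last exact: xB.
(* Since [w] is the only neighbour of [u] in [W], row [u] of [A *m y] reduces to the term at [w],
   whose coefficient is nonzero. *)
have : (A *m y) (enum_rank u) 0 = 0 by rewrite Ay mxE.
have uw : sedge u w.
  by have := forced w; rewrite !inE eqxx => /and3P[].
rewrite mxE (bigD1 i) //= big1 ?addr0 => [|j ji].
  rewrite mxE iw wW => /eqP; rewrite mulf_eq0 => /predU1P[A0|/eqP//].
  have ui : enum_rank u != i.
    by apply: contraTneq uB => ui; rewrite -(enum_rankK u) ui iw WB.
  have := mx_of_graph_neq0 herm AG ui.
  by rewrite A0 eqxx enum_rankK iw uw.
rewrite mxE; case: ifPn => jW; last by rewrite mulr0.
have uj : enum_rank u != j.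
  by apply: contraTneq uB => uj; rewrite -(enum_rankK u) uj WB.
suff -> : A (enum_rank u) j = 0 by rewrite mul0r.
apply/eqP; rewrite -[_ == _]negbK (mx_of_graph_neq0 herm AG uj) enum_rankK.
apply: contra ji => uj_edge; have := forced (enum_val j).
rewrite !inE jW uj_edge (WB _ jW) /= => /esym/eqP jw.
by apply/eqP/enum_val_inj; rewrite iw.
Qed.

Lemma forcing_set_ker (A : 'M[F]_#|G|) (x : 'cV[F]_#|G|) (X : {set G}) :
    psdmx theta A -> mx_of_graph A -> A *m x = 0 -> psd_forcing_set X ->
    (forall i, enum_val i \in X -> x i 0 = 0) ->
  x = 0.
Proof.
move=> psdA AG Ax /connectP[p Xp lastp] xX.
suff xT i : enum_val i \in last X p -> x i 0 = 0.
  by apply/matrixP => i j; rewrite ord1 mxE xT // -lastp inE.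
clear lastp; elim: p X Xp xX i => //= Y p IHp X /andP[XY Yp] xX.
exact: IHp Yp (psd_step_ker psdA AG Ax XY xX).
Qed.

(** By [forcing_set_ker], restriction to the coordinates in [X], given by the 0-1 matrix [S], is
    injective on the kernel. *)
Lemma nullity_le_forcing (A : 'M[F]_#|G|) (X : {set G}) :
    psdmx theta A -> mx_of_graph A -> psd_forcing_set X ->
  (nullity A <= #|X|)%N.
Proof.
move=> psdA AG forceX.
pose S : 'M[F]_(#|G|, #|X|) := \matrix_(i, j) (enum_val i == enum_val j)%:R.
rewrite /nullity -(mxrank_mul_ker _ S).
suff -> : (kermx A^T :&: kermx S)%MS = 0 by rewrite mxrank0 addn0 rank_leq_col.
apply/eqP/rowV0P => v; rewrite sub_capmx => /andP[/sub_kermxP vA /sub_kermxP vS].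
apply: trmx_inj; rewrite trmx0; apply: (@forcing_set_ker A _ X) => //.
  by rewrite -[A]trmxK -trmx_mul vA trmx0.
move=> i iX; rewrite mxE.
have := congr1 (fun M : 'M_(_, #|X|) => M 0 (enum_rank_in iX (enum_val i))) vS.
rewrite !mxE (bigD1 i) //= mxE enum_rankK_in // eqxx mulr1 big1 ?addr0 // => j ji.
by rewrite mxE enum_rankK_in // (inj_eq enum_val_inj) (negPf ji) mulr0.
Qed.

Lemma max_psd_nullity_le_Zplus : (max_psd_nullity theta G <= Zplus G)%N.
Proof.
rewrite /Zplus; case: arg_minnP => [|X forceX _]; first exact: connect0.
apply/bigmax_leqP => k /asboolP[A [psdA AG <-]]; exact: nullity_le_forcing.
Qed.

Lemma nullity_le_max (A : 'M[F]_#|G|) :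
  psdmx theta A -> mx_of_graph A -> (nullity A <= max_psd_nullity theta G)%N.
Proof.
move=> psdA AG; have lt : (nullity A < #|G|.+1)%N by rewrite ltnS rank_leq_row.
apply: (leq_bigmax_cond (Ordinal lt)); apply/asboolP; by exists A.
Qed.

End PsdNullity.

(** * A Gram matrix attaining nullity at least [r] *)

Section TreeMatrix.
Local Open Scope ring_scope.
Variables (T : sgraph) (r : nat) (x0 : T) (par : T -> T).
Hypothesis parE : forall x y,
  sedge x y = ((x != x0) && (par x == y)) || ((y != x0) && (par y == x)).
Hypothesis root_child : exists x, sedge x0 x.
Let TK := cart_prod T (complete_graph r).

(* The column block of the tree edge {e, par e} is (r+1) I - J on the fiber of
   e and 2 (I + J) on the fiber of par e: these two are inverse up to a scalar,
   and the factor 2 prevents their Gram blocks from cancelling on a fiber. *)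
Definition incidence (p : TK) (c : T * 'I_r) : int :=
  let s := (p.1 == c.1)%:R in let t := (p.1 == par c.1)%:R in
  (r.+1%:R * s + 2 * t) * (p.2 == c.2)%:R + (2 * t - s).

(** Column indices: a vertex [e] other than the root encodes the tree edge from [e] to [par e]. *)
Definition nonroot : {set T * 'I_r} := setX [set~ x0] [set: 'I_r].

(** Integer entries let a single computation of the zero pattern serve every [numFieldType]. *)
Definition gram (p q : TK) : int :=
  \sum_(c in nonroot) incidence p c * incidence q c.

(** This is the entry at [(i, k)] of the product of aI + bJ and cI + dJ, where J is the all-ones
    matrix. *)
Lemma sum_affine_delta (a b c d : int) (i k : 'I_r) :
  \sum_(j < r) (a * (i == j)%:R + b) * (c * (k == j)%:R + d) =
  a * c * (i == k)%:R + a * d + b * c + b * d * r%:R.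
Proof.
have sum_delta (f : 'I_r -> int) l : \sum_(j < r) (l == j)%:R * f j = f l.
  rewrite (bigD1 l) //= eqxx mul1r big1 ?addr0 // => j jl.
  by rewrite eq_sym (negPf jl) mul0r.
rewrite (eq_bigr (fun j => a * c * ((i == j)%:R * (k == j)%:R) +
  a * d * ((i == j)%:R * 1) + b * c * ((k == j)%:R * 1) + b * d)); last first.
  by move=> j _; ring.
rewrite !big_split /= -!mulr_sumr !sum_delta sumr_const card_ord !mulr1.
by rewrite (eq_sym k) !mulr_natr mulrnAr.
Qed.

Lemma sum_nonroot_delta (v : T) (f : T -> int) :
  \sum_(e | e != x0) (v == e)%:R * f e = (v != x0)%:R * f v.
Proof.
have [vx0|vx0] := eqVneq v x0; rewrite ?mul0r ?mul1r.
  by rewrite big1 // => e; rewrite vx0 eq_sym => /negPf->; rewrite mul0r.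
rewrite (bigD1 v) //= eqxx mul1r big1 ?addr0 // => e /andP[_ ev].
by rewrite eq_sym (negPf ev) mul0r.
Qed.

(** The mixed terms [s * t'] and [t * s'] drop out of the J part because the two blocks of an edge
    are inverse up to a scalar. *)
Lemma gramE (p q : TK) : gram p q = \sum_(e | e != x0)
  let s := (p.1 == e)%:R in let t := (p.1 == par e)%:R in
  let s' := (q.1 == e)%:R in let t' := (q.1 == par e)%:R in
  (r.+1%:R * s + 2 * t) * (r.+1%:R * s' + 2 * t') * (p.2 == q.2)%:R
  + r.+2%:R * (4 * (t * t') - s * s').
Proof.
rewrite /gram; transitivity (\sum_(e | e != x0) \sum_(j < r)
   incidence p (e, j) * incidence q (e, j)).
  rewrite pair_big_dep /=; apply: eq_big => [[e j]|[e j] _] //.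
  by rewrite !inE andbT.
apply: eq_bigr => e _; rewrite /incidence /= sum_affine_delta.
by rewrite -(addn2 r) -(addn1 r) !natrD; ring.
Qed.

Lemma gram_neq0 (p q : TK) : p != q -> (gram p q != 0) = sedge p q.
Proof.
case: p q => [v i] [w k]; rewrite xpair_eqE /= /cart_rel /= gramE /=.
(* Within a fiber the entry is [r.+2] times 4c - 1, or 4c at the root, where c counts the children
   of [v]. The first is odd; the second is nonzero since the root has a child. *)
have [<-{w}|vw] := eqVneq v w => /=.
  rewrite /complete_rel => ik; rewrite (negPf ik) /=.
  under eq_bigr do rewrite mulr0 add0r.
  rewrite -mulr_sumr; apply/idP; apply: mulf_neq0; first by rewrite pnatr_eq0.
  rewrite big_split /= -mulr_sumr sumrN sum_nonroot_delta.
  set c := \sum_(e | _) _.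
  have -> : c = (\sum_(e | e != x0) (v == par e))%N%:R.
    by rewrite natr_sum; apply: eq_bigr => e _; case: eqP; rewrite ?mulr1 ?mulr0.
  have [vx0|vx0] := eqVneq v x0; last by rewrite eqxx; lia.
  suff : (0 < \sum_(e | e != x0) (v == par e))%N by lia.
  have [y] := root_child; rewrite parE eqxx /= => /andP[yx0 /eqP py].
  by rewrite (bigD1 y) //= py vx0 eqxx.
(* Between distinct fibers only the mixed terms survive, a nonzero multiple of the identity for each
   tree edge. *)
move=> _; rewrite [X in X != 0](_ : _ = 2 * r.+1%:R * (i == k)%:R *
    (((v != x0) && (par v == w))%:R + ((w != x0) && (par w == v))%:R)).
  rewrite parE; case: (i == k); rewrite ?mulr0 ?mul0r ?eqxx ?mulr1 //=.
  have r_neq0 : 2 * r.+1%:R != 0 :> int by rewrite mulf_neq0 ?pnatr_eq0.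
  by rewrite mulf_eq0 (negPf r_neq0); do 2 case: (_ && _).
rewrite -!mulnb !natrM ![par _ == _]eq_sym.
rewrite -[(v != x0)%:R * _](sum_nonroot_delta v (fun e => (w == par e)%:R)).
rewrite -[(w != x0)%:R * _](sum_nonroot_delta w (fun e => (v == par e)%:R)).
rewrite -big_split mulr_sumr; apply: eq_bigr => e _ /=.
have ss : (v == e)%:R * (w == e)%:R = 0 :> int.
  by have [<-|] := eqVneq v e; rewrite ?mul0r // eq_sym (negPf vw) mulr0.
have tt : (v == par e)%:R * (w == par e)%:R = 0 :> int.
  by have [<-|] := eqVneq v (par e); rewrite ?mul0r // eq_sym (negPf vw) mulr0.
by ring: ss tt.
Qed.

Section Field.
Variables (F : numFieldType) (theta : {rmorphism F -> F}).
Hypothesis theta_ge0 : forall x, 0 <= theta x * x.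

Definition incidence_mx : 'M[F]_(#|TK|, #|nonroot|) :=
  \matrix_(i, j) (incidence (enum_val i) (enum_val j))%:~R.

Definition gram_mx : 'M[F]_#|TK| := incidence_mx *m incidence_mx^T.

Lemma gram_mxE i j : gram_mx i j = (gram (enum_val i) (enum_val j))%:~R.
Proof.
rewrite mxE /gram rmorph_sum [RHS]big_enum_val; apply: eq_bigr => c _.
by rewrite !mxE rmorphM.
Qed.

Lemma gram_mx_psd : psdmx theta gram_mx.
Proof.
split.
  apply/is_hermitianmxP; apply/matrixP => i j.
  rewrite expr0 scale1r [RHS]mxE [in RHS]mxE !gram_mxE rmorph_int.
  by congr _%:~R; rewrite /gram; apply: eq_bigr => c _; rewrite mulrC.
move=> x; set y := incidence_mx^T *m x.
have -> : (map_mx theta x^T *m gram_mx *m x) = map_mx theta y^T *m y.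
  rewrite /y trmx_mul map_mxM trmxK !mulmxA; congr (_ *m _ *m _ *m _).
  by apply/matrixP => i j; rewrite !mxE rmorph_int.
by rewrite mxE sumr_ge0 // => i _; rewrite !mxE.
Qed.

Lemma gram_mx_of_graph : mx_of_graph gram_mx.
Proof.
move=> p q; have [->|pq] := eqVneq p q; first by rewrite !sedge_irr.
have rank_neq : enum_rank p != enum_rank q.
  by apply: contra pq => /eqP/enum_rank_inj ->.
rewrite [LHS](mxgraph_relE gram_mx_psd.1 rank_neq) gram_mxE !enum_rankK intr_eq0.
exact: gram_neq0.
Qed.

Lemma nullity_gram_mx : (r <= nullity gram_mx)%N.
Proof.
rewrite /nullity mxrank_ker mxrank_tr.
have rk : (\rank gram_mx <= #|T|.-1 * r)%N.
  apply: leq_trans (mulmx_max_rank _ _) _.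
  by rewrite cardsX cardsC1 cardsT card_ord.
have TKE : #|TK| = (#|T| * r)%N by rewrite card_prod card_ord.
have T_gt0 : (0 < #|T|)%N by apply/card_gt0P; exists x0.
apply: leq_trans (leq_sub2l _ rk).
by rewrite TKE -mulnBl -{1}(prednK T_gt0) subSnn mul1n.
Qed.

End Field.
End TreeMatrix.

(** * Combining the bounds over the real and complex fields *)

Lemma max_psd_nullity_cart_complete (F : numFieldType)
    (theta : {rmorphism F -> F}) (T : sgraph) (r : nat) :
    (forall x, 0 <= theta x * x)%R -> involutive theta ->
    is_tree T -> 2 <= #|T| ->
  max_psd_nullity theta (cart_prod T (complete_graph r)) = r /\
  Zplus (cart_prod T (complete_graph r)) = r.
Proof.
move=> theta_ge0 thetaK treeT T2; have [T0 _ _] := treeT.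
have [x0 _] := card_gt0P T0; have [par parE] := tree_parent treeT x0.
have child := tree_root_child treeT x0 T2.
have MZ := max_psd_nullity_le_Zplus theta_ge0 thetaK (cart_prod T (complete_graph r)).
have Zr := Zplus_le r treeT.
have rM := leq_trans (nullity_gram_mx r x0 par F)
  (nullity_le_max (gram_mx_psd r x0 par theta_ge0) (gram_mx_of_graph parE child theta_ge0)).
split; apply/eqP; rewrite eqn_leq.
  by rewrite (leq_trans MZ Zr) rM.
by rewrite Zr (leq_trans rM MZ).
Qed.

Theorem theorem3p10 (R : realType) (T : sgraph) (r : nat) :
  is_tree T -> 2 <= #|T| -> 1 <= r ->
  [/\ MplusR R (cart_prod T (complete_graph r))
        = MplusC R (cart_prod T (complete_graph r)),
      MplusC R (cart_prod T (complete_graph r))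
        = Zplus (cart_prod T (complete_graph r))
    & Zplus (cart_prod T (complete_graph r)) = r].
Proof.
move=> treeT T2 _.
have id_ge0 (x : R) : (0 <= idfun x * x)%R by rewrite -expr2 sqr_ge0.
have conj_ge0 (z : R[i]) : (0 <= z^* * z)%R by rewrite mulrC mul_conjC_ge0.
have [MR Zr] := max_psd_nullity_cart_complete r id_ge0 (fun=> erefl) treeT T2.
have [MC _] := max_psd_nullity_cart_complete r conj_ge0 conjCK treeT T2.
by rewrite /MplusR /MplusC MR MC Zr.
Qed.
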